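(* Let $\mathcal F=(F;+,\cdot,0,1,\mathrm D)$ be a differentially closed field of characteristic $0$ with a constant $t\in F$, $\mathrm D t=1$, in the language, and $k_0=\mathbb Q(t)$. Let $\mathrm E=\{(x,y)\in F^2: f(x,y)=0\}$ for some differential polynomial $f(X,Y)\in k_0\{X,Y\}$. If $\mathrm E$ contains the graph $\{(x,\mathrm D x):x\in F\}$ of $\mathrm D$, then $\mathrm D$ is quantifier-free definable (without parameters) in the reduct $\mathcal F_{\mathrm E}=(F;+,\cdot,0,1,t,\mathrm E)$.
   Formalization: The differential polynomial f is assumed nonzero; for f = 0 the set E is all of F², which contains the graph of D, but D is not definable in the field (F;+,·,0,1,t), so the statement would be false. *)

(* Defs.v *)
From HB Require Import structures.
From mathcomp Require Import all_boot all_order all_algebra.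
From mathcomp Require Import finmap.
From mathcomp Require Import monalg.

Set Implicit Arguments.
Unset Strict Implicit.
Unset Printing Implicit Defensive.

Import GRing.Theory.
Local Open Scope ring_scope.

Definition derivation (F : fieldType) (D : F -> F) : Prop :=
  {morph D : x y / x + y} /\ (forall x y, D (x * y) = D x * y + x * D y).

(* F{X_0, ..., X_(n-1)}: the commutative polynomials in the infinitely many
   variables (i, k), where (i, k) stands for the k-th derivative of X_i. *)
Definition diffpoly (F : fieldType) (n : nat) : Type :=
  {malg F[{cmonom ('I_n * nat)%type}]}.

Definition dmonom_eval (F : fieldType) (D : F -> F) (n : nat) (a : 'I_n -> F)
    (m : {cmonom ('I_n * nat)%type}) : F :=
  \prod_(ik <- finsupp m) iter ik.2 D (a ik.1) ^+ m ik.

Definition dpoly_eval (F : fieldType) (D : F -> F) (n : nat) (a : 'I_n -> F)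
    (f : diffpoly F n) : F :=
  mmap idfun (dmonom_eval D a) f.

(* One more than the order of f; it is 0 when f lies in F, which corresponds
   to the convention that elements of F have order -1. *)
Definition dpoly_ordS (F : fieldType) (n : nat) (f : diffpoly F n) : nat :=
  (\max_(m <- msupp f) \max_(ik <- finsupp m) ik.2.+1)%N.

(* Differentially closed fields of characteristic 0, by Blum's axioms: if g is
   nonzero and has smaller order than f, then f = 0, g <> 0 has a solution.
   (For f of order 0 this says that F is algebraically closed.) *)
Record dcf0 (F : fieldType) (D : F -> F) : Prop := DCF0 {
  dcf0_char : [pchar F] =i pred0;
  dcf0_derivation : derivation D;
  dcf0_solve : forall f g : diffpoly F 1,
    g != 0 -> (dpoly_ordS g < dpoly_ordS f)%N ->
    exists x : F, dpoly_eval D (fun=> x) f = 0 /\ dpoly_eval D (fun=> x) g <> 0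
}.

(* Membership in the subfield Q(t) of F, for F of characteristic 0. *)
Definition in_Qt (F : fieldType) (t c : F) : Prop :=
  exists p q : {poly rat},
    (map_poly ratr q).[t] != 0 /\
    c = (map_poly ratr p).[t] / (map_poly ratr q).[t].

Definition dpoly_over_Qt (F : fieldType) (t : F) (n : nat) (f : diffpoly F n)
    : Prop :=
  forall m, in_Qt t f@_m.

Definition dpoly_zeros2 (F : fieldType) (D : F -> F) (f : diffpoly F 2)
    (x y : F) : Prop :=
  dpoly_eval D (tnth [tuple x; y]) f = 0.

(* Parameter-free quantifier-free formulas in n variables, in the language
   {+, *, 0, 1, t, E} with E a binary relation symbol. *)
Inductive term (n : nat) : Type :=
| TVar of 'I_n
| TZero
| TOne
| TConst_t
| TAdd of term n & term n
| TMul of term n & term n.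

Inductive qf_formula (n : nat) : Type :=
| FEq of term n & term n
| FRel_E of term n & term n
| FNot of qf_formula n
| FAnd of qf_formula n & qf_formula n
| FOr of qf_formula n & qf_formula n.

Fixpoint term_eval (F : fieldType) (t : F) (n : nat) (v : 'I_n -> F)
    (s : term n) : F :=
  match s with
  | TVar i => v i
  | TZero => 0
  | TOne => 1
  | TConst_t => t
  | TAdd s1 s2 => term_eval t v s1 + term_eval t v s2
  | TMul s1 s2 => term_eval t v s1 * term_eval t v s2
  end.

Fixpoint qf_holds (F : fieldType) (t : F) (E : F -> F -> Prop) (n : nat)
    (v : 'I_n -> F) (phi : qf_formula n) : Prop :=
  match phi with
  | FEq s1 s2 => term_eval t v s1 = term_eval t v s2
  | FRel_E s1 s2 => E (term_eval t v s1) (term_eval t v s2)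
  | FNot phi1 => ~ qf_holds t E v phi1
  | FAnd phi1 phi2 => qf_holds t E v phi1 /\ qf_holds t E v phi2
  | FOr phi1 phi2 => qf_holds t E v phi1 \/ qf_holds t E v phi2
  end.

Definition qf_definable2 (F : fieldType) (t : F) (E S : F -> F -> Prop) : Prop :=
  exists phi : qf_formula 2,
    forall x y : F, S x y <-> qf_holds t E (tnth [tuple x; y]) phi.

(* Main.v *)
(** A pair (x, y) on the graph of D is mapped into the graph, hence into E, by
    every map (x, y) |-> (c(t) + d(t) x, c'(t) + d'(t) x + d(t) y) with c and d
    polynomials with natural coefficients.  If y <> D x, then f, evaluated at
    the image of (x, y), is a polynomial function of the coefficients of c and
    d.  It is not identically zero, because as c and d vary over polynomials of
    large degree the derivatives of the two components (with the coefficients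
    treated as constants) take arbitrary values.  Hence it does not vanish on a
    grid of naturals whose size depends on f only, and y = D x is equivalent to
    a finite conjunction of atoms E(..., ...). *)

Require Import Defs.
From mathcomp Require Import all_boot all_order all_algebra.
From mathcomp Require Import finmap monalg.
From mathcomp Require Import ring.
Import GRing.Theory.
Local Open Scope ring_scope.

(** * Roots among the natural numbers *)

Lemma natr_inj_pchar0 (F : fieldType) :
  [pchar F] =i pred0 -> injective (fun n : nat => n%:R : F).
Proof.
move=> /GRing.pcharf0P F0 m n /= eq_mn.
wlog le_mn : m n eq_mn / (m <= n)%N.
  by move=> W; case/orP: (leq_total m n) => le; [|apply/esym]; apply: W.
apply/eqP; rewrite eqn_leq le_mn /= -subn_eq0 -F0.
by rewrite natrB // eq_mn subrr.
Qed.

(** In characteristic 0 the naturals below [d] give [d] distinct points, too many for all of them to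
    be roots of [p]. *)
Lemma exists_nat_nonroot (F : fieldType) (d : nat) (p : {poly F}) :
  [pchar F] =i pred0 -> p != 0 -> (size p <= d)%N ->
  exists k : 'I_d, p.[(k : nat)%:R] != 0.
Proof.
move=> F0 p0 sp; apply/existsP; apply: contraT => /existsPn /= all_root.
have := @max_poly_roots _ p [seq (k : nat)%:R | k : 'I_d] p0.
rewrite size_map size_enum_ord ltnNge sp; apply.
  by apply/allP => _ /mapP[k _ ->]; have := all_root k; rewrite negbK.
by rewrite map_inj_uniq ?enum_uniq // => i j /(natr_inj_pchar0 _ F0) /val_inj.
Qed.

(** * Polynomial functions in arbitrarily many variables *)

Section PolynomialFunctions.

Variables (F : fieldType) (I : choiceType).
Implicit Types (f : {malg F[{cmonom I}]}) (v w : I -> F).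

Definition mpeval v f : F :=
  \sum_(m <- msupp f) f@_m * \prod_(i <- finsupp m) v i ^+ m i.

(** On a line every variable becomes a polynomial of degree at most one. The size bound, one more
    than the total degree of a nonzero [f], is the same for all lines, which is why the final grid
    depends on [f] only. *)
Lemma mpeval_line f v w : exists2 q : {poly F},
  (size q <= mmeasure mdeg f)%N &
  forall z, mpeval (fun i => v i + z * w i) f = q.[z].
Proof.
pose l i : {poly F} := (v i)%:P + w i *: 'X.
have size_l i : (size (l i) <= 2)%N.
  rewrite (leq_trans (size_polyD _ _)) // geq_max (leq_trans (size_polyC_leq1 _)) //.
  by rewrite (leq_trans (size_scale_leq _ _)) // size_polyX.
exists (\sum_(m <- msupp f) f@_m *: \prod_(i <- finsupp m) l i ^+ m i).
  rewrite big_seq; apply: (big_ind (fun p : {poly F} => (size p <= _)%N)) => [|p q sp sq|m mf].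
  - by rewrite size_poly0.
  - by rewrite (leq_trans (size_polyD _ _)) // geq_max sp.
  - apply: leq_trans (size_scale_leq _ _) _.
    apply: leq_trans (msize_mdeg_lt mf).
    rewrite /mdeg; move: (enum_fset _) => s; elim: s => [|i s IHs].
      by rewrite !big_nil size_poly1.
    rewrite !big_cons (leq_trans (size_polyMleq _ _)) //.
    have : (size (l i ^+ m i) <= (m i).+1)%N.
      rewrite (leq_trans (size_poly_exp_leq _ _)) // ltnS.
      by rewrite -[leqRHS]mul1n leq_mul2r -subn1 leq_subLR size_l orbT.
    move=> size_li; have := leq_sub2r 1 (leq_add size_li IHs).
    by rewrite addSn addnS !subn1.
move=> z; rewrite horner_sum; apply: eq_bigr => m _.
rewrite hornerZ horner_prod; congr (_ * _); apply: eq_bigr => i _.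
by rewrite horner_exp !hornerE mulrC.
Qed.

(* A positional numeral system: [e] lists the powers of [B] along [s]. *)
Lemma exists_injective_weights (B : nat) (s : seq I) : uniq s ->
  exists e : I -> nat, forall m1 m2 : I -> nat,
    {in s, forall i, (m1 i < B)%N} -> {in s, forall i, (m2 i < B)%N} ->
    (\sum_(i <- s) m1 i * e i = \sum_(i <- s) m2 i * e i)%N ->
    {in s, m1 =1 m2}.
Proof.
elim: s => [|x s IHs] /= => [_|/andP[xs us]]; first by exists (fun=> 0%N).
have [e eP] := IHs us.
(* The head [x] receives the units digit, and the digits of the tail move up one place. *)
exists (fun i => if i == x then 1 else B * e i)%N => m1 m2 b1 b2.
have tailE (m : I -> nat) :
    (\sum_(i <- x :: s) m i * (if i == x then 1 else B * e i)
      = (\sum_(i <- s) m i * e i) * B + m x)%N.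
  rewrite big_cons eqxx muln1 addnC; congr (_ + _)%N.
  rewrite big_distrl; apply: eq_big_seq => i si /=.
  by rewrite ifN; [rewrite mulnCA mulnC|apply: contraNneq xs => <-].
rewrite !tailE => eqS.
have B0 : (0 < B)%N by apply: leq_trans (b1 x (mem_head _ _)).
have eqx : m1 x = m2 x.
  have := congr1 (modn^~ B) eqS.
  by rewrite !modnMDl !modn_small ?b1 ?b2 ?mem_head.
move: eqS; rewrite eqx => /addIn /eqP; rewrite eqn_pmul2r // => /eqP eqS.
move=> i; rewrite inE => /orP[/eqP->//|si].
by apply: eP => // j sj; [apply: b1|apply: b2]; rewrite inE sj orbT.
Qed.

(* Kronecker substitution: [v i = z ^ e i], where the weights [e] send the
   monomials of [f] to distinct powers of [z]. *)
Lemma mpeval_neq0 f : [pchar F] =i pred0 -> f != 0 ->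
  exists v, mpeval v f != 0.
Proof.
move=> F0 f0.
pose vars : seq I :=
  undup (flatten [seq enum_fset (finsupp m) | m : {cmonom I} <- msupp f]).
(* [B] exceeds the degree of each monomial of [f], so all exponents are digits in base [B]. *)
pose B := mmeasure mdeg f.
have [e eP] := exists_injective_weights B vars (undup_uniq _).
have vars_sub m i : m \in msupp f -> i \in finsupp m -> i \in vars.
  move=> mf im; rewrite mem_undup; apply/flattenP.
  by exists (enum_fset (finsupp m)) => //; apply: map_f.
have ltB m i : m \in msupp f -> (m i < B)%N.
  move=> mf; apply: leq_trans (msize_mdeg_lt mf); rewrite ltnS.
  case: (finsuppP m i) => // im.
  by rewrite /mdeg (big_rem i) //= leq_addr.
pose wt (m : {cmonom I}) := (\sum_(i <- finsupp m) m i * e i)%N.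
have wtE m : m \in msupp f -> wt m = (\sum_(i <- vars) m i * e i)%N.
  move=> mf; rewrite [RHS](bigID (mem (finsupp m))) /=.
  rewrite [X in (_ + X)%N]big1 => [|i]; last by case: finsuppP.
  rewrite addn0 -[RHS]big_filter; apply/perm_big/uniq_perm => [||i].
  - exact: fset_uniq.
  - exact/filter_uniq/undup_uniq.
  - by rewrite mem_filter andb_idr // => im; apply: vars_sub im.
have wt_inj : {in msupp f &, injective wt}.
  move=> m1 m2 m1f m2f; rewrite !wtE // => eq_wt.
  apply/eqP/cmP => i.
  have [iv|iv] := boolP (i \in vars).
    by apply: eP eq_wt i iv => j _; apply: ltB.
  have out m : m \in msupp f -> m i = 0%N.
    by move=> mf; case: (finsuppP m i) => // /(vars_sub _ _ mf); rewrite (negPf iv).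
  by rewrite !out.
pose p : {poly F} := \sum_(m <- msupp f) f@_m *: 'X^(wt m).
have p0 : p != 0.
  have : msupp f != fset0 by rewrite msupp_eq0.
  (* Since [wt] is injective on the support, nothing cancels: the coefficient of [p] at [wt m] is
     [f@_m]. *)
  case/fset0Pn => m mf; apply/eqP => /(congr1 (fun q : {poly F} => q`_(wt m))).
  rewrite coef0 coef_sum (big_fsetD1 m) //= coefZ coefXn eqxx mulr1 big_seq big1 => [|m'].
    by apply/eqP; rewrite addr0 mcoeff_neq0.
  rewrite in_fsetD1 => /andP[ne m'f]; rewrite coefZ coefXn.
  case: eqP => [eq_wt|_]; last by rewrite mulr0.
  by rewrite (wt_inj m m') ?eqxx in ne.
have [z pz] := exists_nat_nonroot _ (size p) p F0 p0 (leqnn _).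
exists (fun i => (z : nat)%:R ^+ e i).
rewrite (_ : mpeval _ _ = p.[(z : nat)%:R]) // horner_sum.
apply: eq_bigr => m _; rewrite hornerZ hornerXn; congr (_ * _).
rewrite /wt expr_sum; apply: eq_bigr => i _.
by rewrite -exprM mulnC.
Qed.

Lemma eq_mpeval f v w :
  (forall m i, m \in msupp f -> i \in finsupp m -> v i = w i) ->
  mpeval v f = mpeval w f.
Proof.
move=> eq_vw; apply: eq_big_seq => m mf; congr (_ * _).
by apply: eq_big_seq => i im; rewrite (eq_vw m).
Qed.

End PolynomialFunctions.

(** * Order bounds and polynomials with natural coefficients *)

Lemma dpoly_ordS_gt (F : fieldType) (n : nat) (f : diffpoly F n) m ik :
  m \in msupp f -> ik \in finsupp m -> (ik.2 < dpoly_ordS f)%N.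
Proof.
move=> mf im; apply: leq_trans (leq_bigmax_seq _ mf isT).
by rewrite (big_rem ik) //= leq_max leqnn.
Qed.

Definition natpoly (F : fieldType) (s : seq nat) : {poly F} :=
  Poly [seq a%:R | a <- s].

Lemma natpoly_cons (F : fieldType) (a : nat) (s : seq nat) :
  natpoly F (a :: s) = natpoly F s * 'X + a%:R%:P.
Proof. by rewrite /natpoly /= cons_poly_def. Qed.

(** The coefficients of [P] are replaced by naturals one at a time, from the highest degree down.
    Each replacement moves along a line, where [Phi] is a polynomial in one variable. *)
Lemma exists_natpoly_nonroot (F : fieldType) (d n : nat)
    (Phi : {poly F} -> F) (P : {poly F}) :
  [pchar F] =i pred0 ->
  (forall P Q : {poly F}, exists2 q : {poly F},
     (size q <= d)%N & forall z, Phi (P + z *: Q) = q.[z]) ->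
  (size P <= n)%N -> Phi P != 0 ->
  exists s : n.-tuple 'I_d, Phi (natpoly F [seq val i | i <- s]) != 0.
Proof.
move=> F0; elim: n P Phi => [|n IHn] P Phi line sP PhiP.
  exists [tuple]; rewrite /natpoly /=.
  by move: sP PhiP; rewrite leqn0 size_poly_eq0 => /eqP->.
have defP : P = drop_poly 1 P * 'X + (P`_0)%:P.
  rewrite -[LHS](poly_take_drop 1) addrC; congr (_ + _).
  by apply/polyP => -[|i]; rewrite coef_take_poly coefC.
have [Q R|||s /= Phi_s] := IHn (drop_poly 1 P) (fun Q => Phi (Q * 'X + (P`_0)%:P)).
- have [q sq qE] := line (Q * 'X + (P`_0)%:P) (R * 'X).
  by exists q => // z; rewrite -qE mulrDl scalerAl addrAC.
- by rewrite size_drop_poly leq_subLR.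
- by rewrite -defP.
(* The higher coefficients are now natural; the constant one varies in the direction [1]. *)
have [q sq qE] := line (natpoly F [seq val i | i <- s] * 'X) 1.
have q0 : q != 0.
  by apply: contraNneq Phi_s => q0; rewrite -alg_polyC qE q0 horner0.
have [k qk] := exists_nat_nonroot _ d q F0 q0 sq.
by exists [tuple of k :: s]; rewrite /= natpoly_cons -alg_polyC qE.
Qed.

Lemma tnth_pair0 (T : Type) (x y : T) : tnth [tuple x; y] ord0 = x.
Proof. by []. Qed.

Lemma tnth_pair1 (T : Type) (x y : T) : tnth [tuple x; y] ord_max = y.
Proof. by []. Qed.

(** * Derivatives of the components of the shifted pair *)

Section Twist.

Variables (F : fieldType) (D : F -> F) (t : F).
Hypotheses (F0 : [pchar F] =i pred0) (derD : derivation D) (Dt : D t = 1).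

Lemma derivation0 : D 0 = 0.
Proof. by have := derD.1 0 0; rewrite addr0 -{1}[D 0]addr0 => /addrI. Qed.

Lemma derivation1 : D 1 = 0.
Proof.
by have := derD.2 1 1; rewrite !mulr1 mul1r -{1}[D 1]addr0 => /addrI.
Qed.

Lemma derivation_natmul x n : D (x *+ n) = D x *+ n.
Proof.
elim: n => [|n IHn]; first by rewrite !mulr0n derivation0.
by rewrite !mulrS derD.1 IHn.
Qed.

Lemma derivation_horner (P : {poly F}) :
  (forall i, D P`_i = 0) -> D P.[t] = P^`().[t].
Proof.
elim/poly_ind: P => [|P a IHP] DP.
  by rewrite horner0 derivation0 deriv0 horner0.
rewrite !hornerE derD.1 derD.2 Dt mulr1 IHP => [|i].
  have := DP 0%N; rewrite coefD coefMX coefC /= add0r => ->.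
  by rewrite addr0 derivD derivC derivM derivX mulr1 !hornerE addrC.
by have := DP i.+1; rewrite coefD coefMX coefC /= addr0.
Qed.

(* The extension of [P |-> iter k D (P.[t] * u)] from polynomials with constant
   coefficients to all of {poly F}, linear over F. *)
Fixpoint twist (k : nat) (u : F) (P : {poly F}) : F :=
  if k is k'.+1 then twist k' (D u) P + twist k' u P^`() else P.[t] * u.

(** By the Leibniz rule the innermost [D] falls either on [u] or on [P.[t]], where it acts as formal
    differentiation because [D t = 1]. These are the two summands of [twist]. *)
Lemma iter_derivation_horner k u (P : {poly F}) : (forall i, D P`_i = 0) ->
  iter k D (P.[t] * u) = twist k u P.
Proof.
have iterD j x y : iter j D (x + y) = iter j D x + iter j D y.
  by elim: j => //= j ->; rewrite derD.1.
elim: k u P => // k IHk u P DP.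
rewrite iterSr derD.2 derivation_horner // iterD addrC /= !IHk // => i.
by rewrite coef_deriv derivation_natmul DP mul0rn.
Qed.

Lemma twist0 k P : twist k 0 P = 0.
Proof.
elim: k P => [|k IHk] P /=; first by rewrite mulr0.
by rewrite derivation0 !IHk addr0.
Qed.

Lemma twistDl k u v P : twist k (u + v) P = twist k u P + twist k v P.
Proof.
elim: k u v P => [|k IHk] u v P /=; first by rewrite mulrDr.
by rewrite derD.1 !IHk addrACA.
Qed.

Lemma twist_linear k u P Q (z : F) :
  twist k u (P + z *: Q) = twist k u P + z * twist k u Q.
Proof.
elim: k u P Q => [|k IHk] u P Q /=; first by rewrite hornerD hornerZ mulrDl mulrA.
by rewrite derivD derivZ !IHk mulrDr addrACA.
Qed.

Lemma twist_zero k u : twist k u 0 = 0.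
Proof.
by elim: k u => [|k IHk] u /=; rewrite ?deriv0 ?IHk ?addr0 // horner0 mul0r.
Qed.

Lemma twistZ k u P (z : F) : twist k u (z *: P) = z * twist k u P.
Proof. by rewrite -[z *: P]add0r twist_linear twist_zero add0r. Qed.

Lemma deriv_exp_XsubC n :
  (('X - t%:P) ^+ n.+1)^`() = n.+1%:R *: ('X - t%:P) ^+ n :> {poly F}.
Proof. by rewrite deriv_exp derivXsubC mul1r scaler_nat. Qed.

(** Each formal derivative lowers the order of vanishing at [t] by one, so fewer than [n] of them
    leave a zero at [t]. *)
Lemma twist_XsubC_lt k n u : (k < n)%N -> twist k u (('X - t%:P) ^+ n) = 0.
Proof.
elim: k n u => [|k IHk] [|n] u //= lt_kn.
  by rewrite !hornerE subrr exprS !mul0r.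
by rewrite IHk ?(ltnW lt_kn) // deriv_exp_XsubC twistZ IHk // mulr0 addr0.
Qed.

Lemma twist_XsubC n u : twist n u (('X - t%:P) ^+ n) = n`!%:R * u.
Proof.
elim: n u => [|n IHn] u /=; first by rewrite expr0 hornerC.
rewrite twist_XsubC_lt // add0r deriv_exp_XsubC twistZ IHn.
by rewrite mulrA -natrM -factS.
Qed.

(** The system is triangular: adding a multiple of the [n]-th power of ['X - t%:P] adjusts the value
    at [n] and keeps those below. The pivot, [n] factorial times [u], is nonzero in characteristic
    0. *)
Lemma twist_onto n u (a : nat -> F) : u != 0 -> exists P : {poly F},
  (size P <= n)%N /\ forall k, (k < n)%N -> twist k u P = a k.
Proof.
move=> u0; elim: n => [|n [P [sP PE]]]; first by exists 0; rewrite size_poly0.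
have fu0 : n`!%:R * u != 0.
  by move/GRing.pcharf0P: F0 => natr_eq0; rewrite mulf_neq0 // natr_eq0 -lt0n fact_gt0.
exists (P + (a n - twist n u P) / (n`!%:R * u) *: ('X - t%:P) ^+ n); split.
  rewrite (leq_trans (size_polyD _ _)) // geq_max (leqW sP) /=.
  by rewrite (leq_trans (size_scale_leq _ _)) // size_exp_XsubC.
move=> k; rewrite ltnS leq_eqVlt => /orP[/eqP->|lt_kn]; rewrite twist_linear.
  by rewrite twist_XsubC divfK // addrC subrK.
by rewrite twist_XsubC_lt // mulr0 addr0 PE.
Qed.

(* The values at (c(t) + d(t) x, c'(t) + d'(t) x + d(t) y) of the differential
   variables, when the coefficients of c and d are constants. *)
Definition jet (x y : F) (c d : {poly F}) (ik : 'I_2 * nat) : F :=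
  if ik.1 == ord0 then twist ik.2 1 c + twist ik.2 x d
  else twist ik.2 1 c^`() + (twist ik.2 x d^`() + twist ik.2 y d).

Lemma jet_linear x y c d c' d' (z : F) ik :
  jet x y (c + z *: c') (d + z *: d') ik = jet x y c d ik + z * jet x y c' d' ik.
Proof.
by rewrite /jet; case: ifP => _; rewrite ?derivD ?derivZ !twist_linear; ring.
Qed.

(* With u = y - D x, the k-th derivative of the second component minus the
   k.+1-st derivative of the first one is the k-th derivative of d(t) u. *)
Lemma jet_onto x y (v : 'I_2 * nat -> F) n : y != D x ->
  exists c d : {poly F}, [/\ (size c <= n.+1)%N, (size d <= n.+1)%N &
    forall ik, (ik.2 < n)%N -> jet x y c d ik = v ik].
Proof.
rewrite -subr_eq0 => u0.
have [d [sd dE]] := twist_onto n (y - D x)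
  (fun k => v (ord_max, k) - v (ord0, k.+1)) u0.
(* The bound is [n.+1] because order [k] of the second component uses order [k.+1] of the first. *)
have [c [sc cE]] := twist_onto n.+1 1
  (fun k => v (ord0, k) - twist k x d) (oner_neq0 _).
exists c, d; split=> //; first exact: leqW.
case=> i k /= lt_kn; rewrite /jet /=; have [->|i0] := eqVneq i ord0.
  by rewrite cE ?subrK // ltnW.
have -> : i = ord_max by case: i i0 => -[|[|]] //= ? _; apply: val_inj.
(* As [D 1 = 0], [twist k.+1 1 c] reduces to the contribution of [c] to the second component. *)
have := cE k.+1 lt_kn; rewrite /= derivation1 twist0 add0r => ->.
have -> : twist k y d = twist k (y - D x) d + twist k (D x) d.
  by rewrite -twistDl subrK.
by rewrite dE //; ring.
Qed.

Lemma natpoly_const s i : D (natpoly F s)`_i = 0.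
Proof.
rewrite coef_Poly; have [lt_is|le_si] := ltnP i (size s).
  by rewrite (nth_map 0%N) // derivation_natmul derivation1 mul0rn.
by rewrite nth_default ?derivation0 // size_map.
Qed.

(** Natural coefficients are constants of [D], so here the formal jet agrees with the true
    derivatives. *)
Lemma jet_natpoly x y s1 s2 (c := natpoly F s1) (d := natpoly F s2) ik :
  iter ik.2 D (tnth [tuple c.[t] + d.[t] * x;
                           c^`().[t] + (d^`().[t] * x + d.[t] * y)] ik.1)
  = jet x y c d ik.
Proof.
have iterD j a b : iter j D (a + b) = iter j D a + iter j D b.
  by elim: j => //= j ->; rewrite derD.1.
have [c0 d0] := (natpoly_const s1, natpoly_const s2).
have dc0 s i : D (natpoly F s)^`()`_i = 0.
  by rewrite coef_deriv derivation_natmul natpoly_const mul0rn.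
case: ik => i k; rewrite /jet /=; have [->|i0] := eqVneq i ord0.
  rewrite tnth_pair0 -[c.[t]]mulr1 iterD.
  by rewrite !iter_derivation_horner.
have -> : i = ord_max by case: i i0 => -[|[|]] //= ? _; apply: val_inj.
rewrite tnth_pair1 -[c^`().[t]]mulr1 !iterD.
by rewrite !iter_derivation_horner //; apply: dc0.
Qed.

(** Polynomials [c] and [d] over [F] first realise a point where [f], as a polynomial function, is
    nonzero; then the coefficients of [c], and after them those of [d], are made natural. *)
Lemma exists_natpoly_shift_nonzero (f : diffpoly F 2) (x y : F) :
  f != 0 -> y != D x ->
  exists s1 s2 : (dpoly_ordS f).+1.-tuple 'I_(mmeasure mdeg f),
    let c := natpoly F [seq val i | i <- s1] in
    let d := natpoly F [seq val i | i <- s2] in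
    ~ dpoly_zeros2 D f (c.[t] + d.[t] * x)
                       (c^`().[t] + (d^`().[t] * x + d.[t] * y)).
Proof.
move=> f0 yDx; have [v fv] := mpeval_neq0 _ _ f F0 f0.
have [c [d [sc sd jetE]]] := jet_onto x y v (dpoly_ordS f) yDx.
have Phi_cd : mpeval _ _ (jet x y c d) f != 0.
  rewrite (eq_mpeval _ _ _ _ v) // => m ik mf im.
  by apply: jetE; apply: dpoly_ordS_gt mf im.
(* For fixed [d] the jet is affine in [c], so a line of polynomials [c] maps to a line of jets. *)
have [|s1 Phi_1] := exists_natpoly_nonroot _ (mmeasure mdeg f) _
  (fun c => mpeval _ _ (jet x y c d) f) c F0 _ sc Phi_cd.
  move=> P Q.
  have [q sq qE] := mpeval_line _ _ f (jet x y P d) (jet x y Q 0).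
  exists q => // z; rewrite -qE; apply: eq_mpeval => m ik _ _.
  by rewrite -jet_linear scaler0 addr0.
pose c1 := natpoly F [seq val i | i <- s1].
have [|s2 Phi_2] := exists_natpoly_nonroot _ (mmeasure mdeg f) _
  (fun d => mpeval _ _ (jet x y c1 d) f) d F0 _ sd Phi_1.
  move=> P Q.
  have [q sq qE] := mpeval_line _ _ f (jet x y c1 P) (jet x y 0 Q).
  exists q => // z; rewrite -qE; apply: eq_mpeval => m ik _ _.
  by rewrite -jet_linear scaler0 addr0.
exists s1, s2 => /= f_eq0; move/eqP: Phi_2; apply; rewrite -f_eq0.
by apply: eq_mpeval => m ik _ _; rewrite -jet_natpoly.
Qed.

(** This keeps shifted graph points on the graph, which gives the easy implication. *)
Lemma natpoly_shift_graph x s1 s2 (c := natpoly F s1) (d := natpoly F s2) :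
  D (c.[t] + d.[t] * x) = c^`().[t] + (d^`().[t] * x + d.[t] * D x).
Proof. by rewrite derD.1 derD.2 !derivation_horner //; apply: natpoly_const. Qed.

End Twist.

(** * Terms for the shifts and finite conjunctions *)

Fixpoint nat_term (n k : nat) : term n :=
  if k is k'.+1 then TAdd (TOne n) (nat_term n k') else TZero n.

Fixpoint natpoly_term (n : nat) (s : seq nat) : term n :=
  if s is a :: s' then
    TAdd (TMul (natpoly_term n s') (TConst_t n)) (nat_term n a)
  else TZero n.

(** The recursion is the product rule: P X + a has derivative P' X + P. *)
Fixpoint deriv_natpoly_term (n : nat) (s : seq nat) : term n :=
  if s is a :: s' then
    TAdd (TMul (deriv_natpoly_term n s') (TConst_t n)) (natpoly_term n s')
  else TZero n.

Section TermEval.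

Variables (F : fieldType) (t : F) (n : nat) (v : 'I_n -> F).

Lemma nat_termE k : term_eval t v (nat_term n k) = k%:R.
Proof. by elim: k => //= k ->; rewrite mulrS. Qed.

Lemma natpoly_termE s :
  term_eval t v (natpoly_term n s) = (natpoly F s).[t].
Proof.
elim: s => [|a s IHs]; first by rewrite /natpoly /= horner0.
by rewrite natpoly_cons !hornerE /= IHs nat_termE.
Qed.

Lemma deriv_natpoly_termE s :
  term_eval t v (deriv_natpoly_term n s) = (natpoly F s)^`().[t].
Proof.
elim: s => [|a s IHs]; first by rewrite /natpoly /= deriv0 horner0.
rewrite natpoly_cons derivD derivM derivC derivX !hornerE /=.
by rewrite IHs natpoly_termE.
Qed.

End TermEval.

Lemma qf_conj_exists (F : fieldType) (t : F) (E : F -> F -> Prop) (n : nat)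
    (T : finType) (phi : T -> qf_formula n) :
  exists psi, forall v, qf_holds t E v psi <-> forall a, qf_holds t E v (phi a).
Proof.
have [psi psiP] : exists psi, forall v,
    qf_holds t E v psi <-> forall a, a \in enum T -> qf_holds t E v (phi a).
  elim: (enum T) => [|b s [psi IHs]]; first by exists (FEq (TZero n) (TZero n)).
  exists (FAnd (phi b) psi) => v /=; split=> [[hb /IHs hs] a|h].
    by rewrite inE => /orP[/eqP->|/hs].
  by split; [|apply/IHs => a sa]; apply: h; rewrite inE ?eqxx ?sa ?orbT.
exists psi => v; rewrite psiP; split=> h a; last by move=> _; apply: h.
by apply: h; rewrite mem_enum.
Qed.

Theorem theorem5p3 (F : fieldType) (D : F -> F) (t : F)
    (F_dcf0 : dcf0 D) (Dt : D t = 1)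
    (f : diffpoly F 2) (f_over : dpoly_over_Qt t f) (f_neq0 : f != 0)
    (graph_sub : forall x : F, dpoly_zeros2 D f x (D x)) :
  qf_definable2 t (dpoly_zeros2 D f) (fun x y => y = D x).
Proof.
have [F0 derD _] := F_dcf0.
(* This type is finite and depends on [f] only, so one conjunction serves all [x] and [y]. *)
pose tup := (dpoly_ordS f).+1.-tuple 'I_(mmeasure mdeg f).
pose co (s : tup) : seq nat := [seq val i | i <- s].
pose X := TVar (ord0 : 'I_2); pose Y := TVar (ord_max : 'I_2).
pose lin (s : tup * tup) := FRel_E
  (TAdd (natpoly_term 2 (co s.1)) (TMul (natpoly_term 2 (co s.2)) X))
  (TAdd (deriv_natpoly_term 2 (co s.1))
     (TAdd (TMul (deriv_natpoly_term 2 (co s.2)) X)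
           (TMul (natpoly_term 2 (co s.2)) Y))).
have [psi psiP] := qf_conj_exists _ t (dpoly_zeros2 D f) _ _ lin.
exists psi => x y; rewrite psiP /=.
split=> [-> [s1 s2]|h].
  rewrite /= !natpoly_termE !deriv_natpoly_termE tnth_pair0 tnth_pair1.
  by rewrite -(natpoly_shift_graph _ _ _ derD Dt).
apply/eqP; apply: contraT => yDx.
have [s1 [s2 /= []]] := exists_natpoly_shift_nonzero _ _ _ F0 derD Dt _ _ _ f_neq0 yDx.
by have := h (s1, s2); rewrite /= !natpoly_termE !deriv_natpoly_termE tnth_pair0 tnth_pair1.
Qed.
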